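(* Let $V$ be a JB-algebra, let $x,y\in V$, and let $\pi:C(x,y)\to B(H)$ be any isometric representation, into the bounded operators on a complex Hilbert space $H$, of the closed JB-subalgebra $C(x,y)$ of $V$ generated by $1,x,y$. Then for $G(\lambda)=\frac{\sinh(\lambda)}{\lambda}$ we have $$\pi\big(G(\mathrm{ad}\,L_x)(L_y)(1)\big)=G\Big(\mathrm{ad}\,\frac{\pi(x)}{2}\Big)\pi(y).$$
   Context: A JB-algebra is a real Banach space $V$ with a bilinear commutative product $\circ$ and unit $1$ such that $x^2\circ(x\circ y)=x\circ(x^2\circ y)$, $\|x\circ y\|\le\|x\|\|y\|$, $\|x^2\|=\|x\|^2$ and $\|x^2\|\le\|x^2+y^2\|$. $L_x$ is the bounded operator $L_xy=x\circ y$ on $V$. In an associative Banach algebra, $\mathrm{ad}\,A(B)=AB-BA$, and $G(\mathrm{ad}\,A)$ is defined by the power series of the entire function $G(\lambda)=\sinh(\lambda)/\lambda$, $G(0)=1$. Thus $G(\mathrm{ad}\,L_x)(L_y)$ is a bounded operator on $V$, which is evaluated at $1\in V$. An isometric representation $\pi$ of $C(x,y)$ in $H$ is an isometric real-linear map into the self-adjoint operators on $H$ with $\pi(a\circ b)=\tfrac12(\pi(a)\pi(b)+\pi(b)\pi(a))$. *)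

(* Defs.v *)
From HB Require Import structures.
From mathcomp Require Import all_boot all_order all_algebra sesquilinear.
From mathcomp Require Import complex.
From mathcomp Require Import all_classical all_reals.
From mathcomp Require Import topology normedtype sequences.

Set Implicit Arguments.
Unset Strict Implicit.
Unset Printing Implicit Defensive.

Import Order.TTheory GRing.Theory Num.Theory.
Import numFieldNormedType.Exports.

Local Open Scope classical_set_scope.
Local Open Scope ring_scope.

(* A number field K whose real elements form a copy of R; the instances are
   R itself and R[i].  Norms in a normedModType R[i] are R[i]-valued; this
   structure makes them, and hence operator norms, R-valued. *)
HB.mixin Record isRealOrComplex (R : realType) K & Num.NumField K := {
  ofreal : {rmorphism R -> K};
  realpart : K -> R;
  ler_ofreal : {mono ofreal : a b / a <= b};
  ofrealK : cancel ofreal realpart;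
  realpartK : forall z : K, z \is Num.real -> ofreal (realpart z) = z;
}.

#[short(type="realOrComplexType")]
HB.structure Definition RealOrComplex (R : realType) :=
  {K of Num.NumField K & isRealOrComplex R K}.

Arguments ofreal {R K} : rename.
Arguments realpart {R K} : rename.

HB.instance Definition _ (R : realType) :=
  @isRealOrComplex.Build R R idfun idfun (fun _ _ => erefl) (fun _ => erefl)
    (fun _ _ => erefl).

Section ComplexInstance.
Variable R : realType.

Lemma ler_real_complex : {mono (real_complex R) : a b / a <= b}.
Proof. exact: lecR. Qed.

Lemma Re_real_complex : cancel (real_complex R) (@complex.Re R).
Proof. by []. Qed.

Lemma real_complex_Re (z : R[i]) : z \is Num.real -> real_complex R (complex.Re z) = z.
Proof. by move=> zr; rewrite RRe_real. Qed.

HB.instance Definition _ := @isRealOrComplex.Build R R[i] (real_complex R)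
  (@complex.Re R) ler_real_complex Re_real_complex real_complex_Re.

End ComplexInstance.

Section RealNorm.
Variables (R : realType) (K : realOrComplexType R) (E : normedModType K).

Definition rnorm (v : E) : R := realpart `|v|.

Lemma rnormK v : ofreal (rnorm v) = `|v|.
Proof. by rewrite realpartK// normr_real. Qed.

Lemma ofreal_ltr (a b : R) : (ofreal a < ofreal b :> K) = (a < b).
Proof. by rewrite !lt_neqAle ler_ofreal (inj_eq (can_inj ofrealK)). Qed.

Lemma rnorm_ge0 v : 0 <= rnorm v.
Proof. by rewrite -(@ler_ofreal R K) rmorph0 rnormK. Qed.

Lemma rnorm0 : rnorm 0 = 0.
Proof. by rewrite /rnorm normr0 -(rmorph0 (@ofreal R K)) ofrealK. Qed.

Lemma rnorm0_eq0 v : rnorm v = 0 -> v = 0.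
Proof. by move=> v0; apply: normr0_eq0; rewrite -rnormK v0 rmorph0. Qed.

Lemma ler_rnormD v w : rnorm (v + w) <= rnorm v + rnorm w.
Proof. by rewrite -(@ler_ofreal R K) rmorphD !rnormK ler_normD. Qed.

Lemma rnormN v : rnorm (- v) = rnorm v.
Proof. by rewrite /rnorm normrN. Qed.

Lemma rnormZ (k : R) v : rnorm (ofreal k *: v) = `|k| * rnorm v.
Proof.
rewrite /rnorm normrZ.
have -> : `|ofreal k| = ofreal `|k| :> K.
  have [k0|k0] := lerP 0 k.
    by rewrite !ger0_norm// -(rmorph0 (@ofreal R K)) ler_ofreal.
  by rewrite !ltr0_norm ?rmorphN// -(rmorph0 (@ofreal R K)) ofreal_ltr.
by rewrite -[`|v|]rnormK -rmorphM !ofrealK.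
Qed.

End RealNorm.

Section BoundedOperators.
Variables (R : realType) (K : realOrComplexType R) (E : normedModType K).

Definition bounded_operator (f : E -> E) :=
  linear f /\ exists M : R, forall v, rnorm (f v) <= M * rnorm v.

(* B(E), for a real or complex normed space E, as a real algebra *)
Record bop := Bop { bop_fun :> E -> E ; _ : `[< bounded_operator bop_fun >] }.

HB.instance Definition _ := [isSub for bop_fun].
HB.instance Definition _ := [Choice of bop by <:].

Implicit Types (T S U : bop) (v : E).

Lemma bopP T : bounded_operator T.
Proof. by apply/asboolP; case: T. Qed.

Definition mk_bop f (bf : bounded_operator f) : bop := Bop (asboolT bf).

Lemma bop_eq T S : (forall v, T v = S v) -> T = S.
Proof. by move=> TS; apply/val_inj/funext. Qed.

HB.instance Definition _ T := GRing.isLinear.Build K E E *:%R T (bopP T).1.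

Lemma bop_bound T : exists2 M : R, 0 <= M &
  forall v, rnorm (T v) <= M * rnorm v.
Proof.
have [_ [M TM]] := bopP T; exists `|M| => // v.
by rewrite (le_trans (TM v))// ler_wpM2r ?rnorm_ge0 ?ler_norm.
Qed.

Fact bop0_subproof : bounded_operator (fun=> 0).
Proof.
split; first by move=> k u v; rewrite scaler0 addr0.
by exists 0 => v; rewrite mul0r rnorm0.
Qed.

Fact bopN_subproof T : bounded_operator (fun v => - T v).
Proof.
split; first by move=> k u v; rewrite linearP opprD scalerN.
by have [M _ TM] := bop_bound T; exists M => v; rewrite rnormN.
Qed.

Fact bopD_subproof T S : bounded_operator (fun v => T v + S v).
Proof.
split; first by move=> k u v; rewrite !linearP scalerDr addrACA.
have [M _ TM] := bop_bound T; have [N _ SN] := bop_bound S.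
by exists (M + N) => v; rewrite (le_trans (ler_rnormD _ _))// mulrDl lerD.
Qed.

Fact bopZ_subproof (k : R) T : bounded_operator (fun v => ofreal k *: T v).
Proof.
split.
  by move=> l u v; rewrite linearP scalerDr !scalerA [_ * l]mulrC.
have [M _ TM] := bop_bound T; exists (`|k| * M) => v.
by rewrite rnormZ -mulrA ler_wpM2l.
Qed.

Fact bop1_subproof : bounded_operator id.
Proof. by split => //; exists 1 => v; rewrite mul1r. Qed.

Fact bopM_subproof T S : bounded_operator (fun v => T (S v)).
Proof.
split; first by move=> k u v; rewrite !linearP.
have [M M0 TM] := bop_bound T; have [N _ SN] := bop_bound S.
exists (M * N) => v; rewrite (le_trans (TM _))// -mulrA ler_wpM2l//.
Qed.

Let bopD T S := mk_bop (bopD_subproof T S).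
Let bopN T := mk_bop (bopN_subproof T).
Let bop0 := mk_bop bop0_subproof.

Fact bopDA : associative bopD.
Proof. by move=> T S U; apply: bop_eq => v /=; rewrite addrA. Qed.

Fact bopDC : commutative bopD.
Proof. by move=> T S; apply: bop_eq => v /=; rewrite addrC. Qed.

Fact bop0D : left_id bop0 bopD.
Proof. by move=> T; apply: bop_eq => v /=; rewrite add0r. Qed.

Fact bopND : left_inverse bop0 bopN bopD.
Proof. by move=> T; apply: bop_eq => v /=; rewrite addNr. Qed.

HB.instance Definition _ := GRing.isZmodule.Build bop bopDA bopDC bop0D bopND.

Lemma bopDE T S v : (T + S) v = T v + S v. Proof. by []. Qed.
Lemma bopNE T v : (- T) v = - T v. Proof. by []. Qed.
Lemma bop0E v : (0 : bop) v = 0. Proof. by []. Qed.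

Let bopM T S := mk_bop (bopM_subproof T S).
Let bop1 := mk_bop bop1_subproof.

Fact bopMA : associative bopM.
Proof. by move=> T S U; apply: bop_eq. Qed.

Fact bop1M : left_id bop1 bopM.
Proof. by move=> T; apply: bop_eq. Qed.

Fact bopM1 : right_id bop1 bopM.
Proof. by move=> T; apply: bop_eq. Qed.

Fact bopMDl : left_distributive bopM +%R.
Proof. by move=> T S U; apply: bop_eq. Qed.

Fact bopMDr : right_distributive bopM +%R.
Proof. by move=> T S U; apply: bop_eq => v; rewrite bopDE /= -linearD. Qed.

HB.instance Definition _ :=
  GRing.Zmodule_isPzRing.Build bop bopMA bop1M bopM1 bopMDl bopMDr.

Lemma bopME T S v : (T * S) v = T (S v). Proof. by []. Qed.
Lemma bop1E v : (1 : bop) v = v. Proof. by []. Qed.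

Let bopZ k T := mk_bop (bopZ_subproof k T).

Fact bopZA k l T : bopZ k (bopZ l T) = bopZ (k * l) T.
Proof. by apply: bop_eq => v /=; rewrite scalerA rmorphM. Qed.

Fact bop1Z : left_id 1 bopZ.
Proof. by move=> T; apply: bop_eq => v /=; rewrite rmorph1 scale1r. Qed.

Fact bopZDr : right_distributive bopZ +%R.
Proof. by move=> k T S; apply: bop_eq => v /=; rewrite scalerDr. Qed.

Fact bopZDl T : {morph bopZ^~ T : k l / k + l}.
Proof. by move=> k l; apply: bop_eq => v /=; rewrite rmorphD scalerDl. Qed.

HB.instance Definition _ :=
  GRing.Zmodule_isLmodule.Build R bop bopZA bop1Z bopZDr bopZDl.

Lemma bopZE (k : R) T v : (k *: T) v = ofreal k *: T v. Proof. by []. Qed.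

Definition opnorm T : R := sup [set rnorm (T v) | v in [set v : E | rnorm v <= 1]].

Lemma opnorm_has_sup T :
  has_sup [set rnorm (T v) | v in [set v : E | rnorm v <= 1]].
Proof.
split; first by exists (rnorm (T 0)), 0 => //=; rewrite rnorm0.
have [M M0 TM] := bop_bound T; exists M => _ [v /= v1 <-].
by rewrite (le_trans (TM v))// -[leRHS]mulr1 ler_wpM2l.
Qed.

Lemma rnorm_unit v : v != 0 -> rnorm (ofreal (rnorm v)^-1 *: v) = 1.
Proof.
move=> v0; have nv : rnorm v != 0.
  by apply: contra_neq v0; exact: rnorm0_eq0.
by rewrite rnormZ ger0_norm ?invr_ge0 ?rnorm_ge0// mulVf.
Qed.

Lemma ler_opnorm T v : rnorm (T v) <= opnorm T * rnorm v.
Proof.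
have [->|v0] := eqVneq v 0; first by rewrite linear0 rnorm0 mulr0.
have nv : 0 < rnorm v.
  rewrite lt_def rnorm_ge0 andbT.
  by apply: contra_neq v0; exact: rnorm0_eq0.
rewrite -ler_pdivrMr// mulrC.
have -> : (rnorm v)^-1 * rnorm (T v) = rnorm (T (ofreal (rnorm v)^-1 *: v)).
  by rewrite linearZ rnormZ ger0_norm// invr_ge0 ltW.
apply: sup_upper_bound; first exact: opnorm_has_sup.
by exists (ofreal (rnorm v)^-1 *: v) => //=; rewrite rnorm_unit.
Qed.

Lemma opnorm_le T (M : R) : 0 <= M ->
  (forall v, rnorm (T v) <= M * rnorm v) -> opnorm T <= M.
Proof.
move=> M0 TM; apply: ge_sup; first by case: (opnorm_has_sup T).
move=> _ [v /= v1 <-].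
by rewrite (le_trans (TM v))// -[leRHS]mulr1 ler_wpM2l.
Qed.

Lemma opnorm_ge0 T : 0 <= opnorm T.
Proof.
apply: sup_upper_bound; first exact: opnorm_has_sup.
by exists 0 => /=; rewrite ?linear0 rnorm0.
Qed.

Fact ler_opnormD T S : opnorm (T + S) <= opnorm T + opnorm S.
Proof.
apply: opnorm_le => [|v]; first by rewrite addr_ge0 ?opnorm_ge0.
by rewrite bopDE (le_trans (ler_rnormD _ _))// mulrDl lerD ?ler_opnorm.
Qed.

Fact opnormZ_le (k : R) T : opnorm (k *: T) <= `|k| * opnorm T.
Proof.
apply: opnorm_le => [|v]; first by rewrite mulr_ge0 ?opnorm_ge0.
by rewrite bopZE rnormZ -mulrA ler_wpM2l ?ler_opnorm.
Qed.

Fact opnormZ (k : R) T : opnorm (k *: T) = `|k| * opnorm T.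
Proof.
apply/eqP; rewrite eq_le opnormZ_le /=.
have [->|k0] := eqVneq k 0; first by rewrite normr0 mul0r opnorm_ge0.
rewrite -ler_pdivlMl ?normr_gt0// -normfV.
by rewrite (le_trans _ (opnormZ_le _ _))// scalerA mulVf// scale1r.
Qed.

Fact opnorm0_eq0 T : opnorm T = 0 -> T = 0.
Proof.
move=> T0; apply: bop_eq => v; apply/rnorm0_eq0/eqP.
by rewrite eq_le rnorm_ge0 andbT (le_trans (ler_opnorm T v))// T0 mul0r.
Qed.

HB.instance Definition _ :=
  Lmodule_isNormed.Build R bop ler_opnormD opnormZ opnorm0_eq0.

Lemma bop_normE T : `|T| = opnorm T. Proof. by []. Qed.

End BoundedOperators.

Section BanachAlgebraOfOperators.
Variables (R : realType) (K : realOrComplexType R).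
Variable E : completeNormedModType K.

Fact bop_complete (F : set_system (bop E)) :
  ProperFilter F -> cauchy F -> cvg F.
Proof.
move=> FF /cauchyP Fc.
have Fnear (e : R) : 0 < e ->
    exists T : bop E, \forall S \near F,
      forall v, rnorm (T v - (S : bop E) v) <= e * rnorm v.
  move=> e0; have [T FT] := Fc e e0.
  exists T; near=> S => v; have TS : `|T - S| < e.
    by near: S; move: FT; rewrite -ball_normE.
  rewrite -[T v - S v]/((T - S) v) (le_trans (ler_opnorm _ _))//.
  by rewrite ler_wpM2r ?rnorm_ge0// ltW.
have cvgF v : cvg ((fun T : bop E => T v) @ F).
  apply: cauchy_cvg; apply: cauchy_exP => e e0.
  have er : ofreal (realpart e) = e by rewrite realpartK// gtr0_real.
  have e'0 : 0 < realpart e by rewrite -(@ofreal_ltr R K) er rmorph0.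
  have v1 : 0 < rnorm v + 1 by rewrite ltr_pwDr ?rnorm_ge0.
  have [|T FT] := Fnear (realpart e / (rnorm v + 1)); first by rewrite divr_gt0.
  exists (T v); apply: filterS FT => S /(_ v) TS.
  rewrite /= -ball_normE /= -rnormK -er ofreal_ltr (le_lt_trans TS)//.
  by rewrite mulrAC ltr_pdivrMr// ltr_pM2l// ltrDl.
pose l v := lim ((fun T : bop E => T v) @ F).
have Fl v : (fun T : bop E => T v) @ F --> l v by exact: cvgF.
have near_l (e : R) : 0 < e -> \forall T \near F,
    forall v, rnorm ((T : bop E) v - l v) <= e * rnorm v.
  move=> e0; have [|T FT] := Fnear (e / 2); first by rewrite divr_gt0.
  apply: filterS (FT) => U TU v; apply/ler_addgt0Pr => d d0.
  have d0' : 0 < ofreal d :> K by rewrite -(rmorph0 (@ofreal R K)) ofreal_ltr.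
  have /cvgrPdist_lt/(_ _ d0') Fd := Fl v.
  have [S [TS Sl]] := filter_ex (filterI FT Fd).
  have {}Sl : rnorm (S v - l v) <= d.
    by rewrite -(@ler_ofreal R K) rnormK distrC ltW.
  have -> : U v - l v = - (T v - U v) + (T v - S v) + (S v - l v).
    by rewrite opprB !subrKA.
  rewrite (le_trans (ler_rnormD _ _))// lerD//.
  by rewrite (le_trans (ler_rnormD _ _))// rnormN [e]splitr mulrDl lerD.
have l_linear : linear l.
  move=> k u v; apply: cvg_lim => //.
  rewrite (_ : (fun T : bop E => T _) = (fun T => k *: T u + T v)).
    by apply: cvgD => //; apply: cvgZl_tmp.
  by apply/funext => T; rewrite linearP.
have l_bounded : bounded_operator l.
  split=> //; near F => T; exists (opnorm T + 1) => v.
  have Tl : rnorm (T v - l v) <= 1 * rnorm v.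
    by move: v; near: T; exact: near_l.
  have -> : l v = T v - (T v - l v) by rewrite opprB addrCA subrr addr0.
  by rewrite (le_trans (ler_rnormD _ _))// rnormN mulrDl lerD// ler_opnorm.
apply/cvg_ex; exists (mk_bop l_bounded); apply/cvgrPdist_le => e e0.
near=> T; rewrite bop_normE; apply: opnorm_le => [|v]; first exact: ltW.
rewrite -[_ v]/(l v - T v) -rnormN opprB.
by move: v; near: T; exact: near_l.
Unshelve. all: by end_near. Qed.

HB.instance Definition _ := Uniform_isComplete.Build (bop E) bop_complete.

Fact bop_scalerAl (k : R) (T S : bop E) : k *: (T * S) = (k *: T) * S.
Proof. exact: bop_eq. Qed.

Fact bop_scalerAr (k : R) (T S : bop E) : k *: (T * S) = T * (k *: S).
Proof. by apply: bop_eq => v; rewrite bopME !bopZE linearZ. Qed.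

Fact bop_normM (T S : bop E) : `|T * S| <= `|T| * `|S|.
Proof.
rewrite !bop_normE; apply: opnorm_le => [|v].
  by rewrite mulr_ge0 ?opnorm_ge0.
rewrite bopME (le_trans (ler_opnorm _ _))// -mulrA.
by rewrite ler_wpM2l ?opnorm_ge0 ?ler_opnorm.
Qed.

End BanachAlgebraOfOperators.

Section PowerSeries.
Variables (R : realType) (K : realOrComplexType R).
Variable E : completeNormedModType K.
Implicit Types T S : bop E.

Fact ad_subproof T : bounded_operator (fun S => T * S - S * T).
Proof.
split=> [k S U|].
  by rewrite mulrDl mulrDr -bop_scalerAl -bop_scalerAr opprD addrACA scalerBr.
exists (`|T| + `|T|) => S.
rewrite (le_trans (ler_rnormD _ _))// rnormN mulrDl lerD//.
  exact: bop_normM.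
by rewrite mulrC; exact: bop_normM.
Qed.

Definition ad T : bop (bop E) := mk_bop (ad_subproof T).

(* G(T), where G(l) = sinh(l) / l = \sum_n l^(2n) / (2n+1)! *)
Definition sinhc T : bop E :=
  limn (series (fun n : nat => ((n.*2.+1)`!%:R : R)^-1 *: T ^+ n.*2)).

End PowerSeries.

HB.mixin Record isJBAlgebra (R : realType) V & CompleteNormedModule R V := {
  jmul : V -> V -> V;
  jone : V;
  jmulC : commutative jmul;
  jmulP : forall x, linear (jmul x);
  jmul1 : left_id jone jmul;
  jordan_identity : forall x y,
    jmul (jmul x x) (jmul x y) = jmul x (jmul (jmul x x) y);
  jb_normM : forall x y, `|jmul x y| <= `|x| * `|y|;
  jb_norm_sqr : forall x, `|jmul x x| = `|x| ^+ 2;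
  jb_norm_sqrD : forall x y, `|jmul x x| <= `|jmul x x + jmul y y|;
}.

#[short(type="jbAlgType")]
HB.structure Definition JBAlgebra (R : realType) :=
  {V of CompleteNormedModule R V & isJBAlgebra R V}.

Arguments jone {R V} : rename.

Section JBTheory.
Variables (R : realType) (V : jbAlgType R).

Fact Lop_subproof (x : V) : bounded_operator (jmul x).
Proof. by split; [exact: jmulP | exists `|x| => y; exact: jb_normM]. Qed.

Definition Lop (x : V) : bop V := mk_bop (Lop_subproof x).

Definition closed_JB_subalgebra (S : set V) :=
  [/\ closed S, S 0,
      forall (k : R) a b, S a -> S b -> S (k *: a + b) &
      forall a b, S a -> S b -> S (jmul a b)].

Definition JBgen (x y : V) : set V :=
  smallest closed_JB_subalgebra [set jone; x; y].

End JBTheory.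

HB.mixin Record isHilbert (R : realType) H & CompleteNormedModule R[i] H := {
  hdot : {dot H for (@Num.conj R[i])};
  hdot_norm : forall u : H, `|u| ^+ 2 = hdot u u;
}.

#[short(type="hilbertType")]
HB.structure Definition Hilbert (R : realType) :=
  {H of CompleteNormedModule R[i] H & isHilbert R H}.

Section Representations.
Variables (R : realType) (V : jbAlgType R) (H : hilbertType R).

Definition selfadjoint (T : bop H) := forall u v, hdot (T u) v = hdot u (T v).

(* pi is a total function, of which only the values on C matter *)
Definition isometric_representation (C : set V) (pi : V -> bop H) :=
  [/\ forall (k : R) a b, C a -> C b -> pi (k *: a + b) = k *: pi a + pi b,
      forall a, C a -> selfadjoint (pi a),
      forall a, C a -> `|pi a| = `|a| &
      forall a b, C a -> C b ->
        pi (jmul a b) = 2^-1 *: (pi a * pi b + pi b * pi a)].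

End Representations.

(* Main.v *)
Require Import Defs.
From mathcomp Require Import all_boot all_order all_algebra.
From mathcomp Require Import all_classical all_reals topology normedtype.
From mathcomp Require Import sequences.

Set Implicit Arguments.
Unset Strict Implicit.
Unset Printing Implicit Defensive.

Import Order.TTheory GRing.Theory Num.Theory.
Local Open Scope classical_set_scope.
Local Open Scope ring_scope.

(** The idea is to replace V by C = C(x, y) and to compute in B(H), where
    L_x becomes the Jordan multiplication by a = pi(x), half the sum of the
    left and the right multiplication by a.  Left multiplications commute with
    right ones, so a commutator of two Jordan multiplications has no mixed
    term: it is half the difference of the left and the right multiplication by
    half of the associative commutator.  Taking the commutator with L_x once
    more gives a Jordan multiplication again.  Hence (ad L_x)^n (L_y) is
    carried by pi to
      T |-> (d_n T + (-1)^n T d_n) / 2   with d_n = (ad (a / 2))^n (pi(y))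
    ([jordan_mult_intertwine_iter]).  The projection e = pi(1) need not be the
    identity of H, but it is a unit for all of pi(C), hence for d_n, so for n
    even the value at e is d_n ([pi_ad_iter]).

    Since G is an even entire function, G(ad L_x)(L_y)(1) is the limit of
    linear combinations of the elements just computed.  They lie in C, which is
    closed, and pi is linear and isometric on C, so it carries the limit in V
    to the limit in B(H). *)

(** * Convergence of the series of G *)

Section EntireSeries.
Variables (R : realType) (K : realOrComplexType R).
Variable E : completeNormedModType K.
Implicit Types T : bop E.

Lemma bop_norm1_le : `|1 : bop E| <= 1.
Proof.
by rewrite bop_normE; apply: opnorm_le => // v; rewrite bop1E mul1r.
Qed.

Lemma bop_normX_le T n : `|T ^+ n| <= `|T| ^+ n.
Proof.
elim: n => [|n IHn]; first by rewrite !expr0 bop_norm1_le.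
by rewrite !exprS (le_trans (bop_normM _ _))// ler_wpM2l.
Qed.

(** The coefficients are dominated by those of the exponential series of
    the square of the norm of T, because n! <= (2n+1)!. *)
Lemma sinhc_series_cvg T :
  series (fun n : nat => ((n.*2.+1)`!%:R : R)^-1 *: T ^+ n.*2) @ \oo
    --> sinhc T.
Proof.
apply: normed_cvg.
apply: (@series_le_cvg _ _ (exp_coeff (`|T| ^+ 2))) => [n|n|n|].
- exact: normr_ge0.
- by rewrite /exp_coeff /= divr_ge0// exprn_ge0// exprn_ge0.
- rewrite /exp_coeff /= normrZ mulrC -exprM mul2n.
  apply: ler_pM => //; first exact: bop_normX_le.
  rewrite ger0_norm; last by rewrite invr_ge0.
  rewrite lef_pV2 ?posrE ?ltr0n ?fact_gt0// ler_nat.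
  by apply: leq_fact; rewrite -addnn -addnS leq_addr.
- exact: is_cvg_series_exp_coeff.
Qed.

End EntireSeries.

Section Evaluation.
Variable R : realType.

Lemma cvg_bop_apply (F : normedModType R) (u : nat -> bop F) (T : bop F) v :
  u @ \oo --> T -> (fun n => u n v) @ \oo --> T v.
Proof.
move=> uT; apply/cvgrPdist_le => e e0.
have v1 : 0 < `|v| + 1 by rewrite ltr_pwDr.
have /cvgrPdist_le/(_ (e / (`|v| + 1))) := uT.
rewrite divr_gt0// => /(_ isT); apply: filterS => n Tu.
apply: le_trans (ler_opnorm (T - u n) v) _.
apply: le_trans (ler_wpM2r (rnorm_ge0 v) Tu) _.
rewrite mulrAC ler_pdivrMr//.
by rewrite ler_pM2l// lerDl.
Qed.

Lemma bop_sumE (F : normedModType R) (f : nat -> bop F) m v :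
  (\sum_(0 <= n < m) f n) v = \sum_(0 <= n < m) f n v.
Proof.
elim: m => [|m IHm]; first by rewrite !big_geq.
by rewrite !big_nat_recr//= IHm.
Qed.

Lemma sinhc_apply_cvg (F : completeNormedModType R) (T : bop F) v :
  (fun m => \sum_(0 <= n < m) ((n.*2.+1)`!%:R : R)^-1 *: (T ^+ n.*2) v) @ \oo
    --> sinhc T v.
Proof.
have /cvg_bop_apply-/(_ v) := @sinhc_series_cvg _ _ _ T.
apply: cvg_trans; apply: near_eq_cvg; near=> m.
by rewrite /series/= bop_sumE.
Unshelve. all: by end_near. Qed.

End Evaluation.

(** * The algebra of the representation *)

Section GeneratedSubalgebra.
Variables (R : realType) (V : jbAlgType R) (x y : V).

Lemma JBgen_closed_JB_subalgebra : closed_JB_subalgebra (JBgen x y).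
Proof.
split.
- by apply: closed_bigI => S [[SC _ _ _] _].
- by move=> S [[_ S0 _ _] _].
- move=> k a b Ca Cb S SP; have [[_ _ SD _] _] := SP.
  by apply: SD; [exact: Ca | exact: Cb].
- move=> a b Ca Cb S SP; have [[_ _ _ SM] _] := SP.
  by apply: SM; [exact: Ca | exact: Cb].
Qed.

Lemma JBgen_gen : [set jone; x; y] `<=` JBgen x y.
Proof. exact: sub_gen_smallest. Qed.

End GeneratedSubalgebra.

Section Intertwining.
Variables (R : realType) (V : jbAlgType R) (H : hilbertType R).
Variables (C : set V) (pi : V -> bop H).
Hypothesis C_alg : closed_JB_subalgebra C.
Hypothesis pi_rep : isometric_representation C pi.

Let CZD (k : R) a b : C a -> C b -> C (k *: a + b).
Proof. by case: C_alg => _ _ + _; exact. Qed.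

Let C0 : C 0. Proof. by case: C_alg. Qed.

Let CM a b : C a -> C b -> C (jmul a b).
Proof. by case: C_alg => _ _ _; exact. Qed.

Let piZD (k : R) a b : C a -> C b -> pi (k *: a + b) = k *: pi a + pi b.
Proof. by case: pi_rep => + _ _ _; exact. Qed.

Let piM a b :
  C a -> C b -> pi (jmul a b) = 2^-1 *: (pi a * pi b + pi b * pi a).
Proof. by case: pi_rep => _ _ _; exact. Qed.

Let pi_norm a : C a -> `|pi a| = `|a|.
Proof. by case: pi_rep => _ _ + _; exact. Qed.

Lemma subalgebraB a b : C a -> C b -> C (a - b).
Proof. by move=> Ca Cb; rewrite addrC -scaleN1r; exact: CZD. Qed.

Lemma representationB a b : C a -> C b -> pi (a - b) = pi a - pi b.
Proof. by move=> Ca Cb; rewrite addrC -scaleN1r piZD// scaleN1r addrC. Qed.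

Lemma representation0 : pi 0 = 0.
Proof. by rewrite -[X in pi X](subrr 0) representationB// subrr. Qed.

Lemma representation_sum (c : nat -> R) (v : nat -> V) m :
  (forall n, C (v n)) ->
  C (\sum_(0 <= n < m) c n *: v n) /\
  pi (\sum_(0 <= n < m) c n *: v n) = \sum_(0 <= n < m) c n *: pi (v n).
Proof.
move=> Cv; elim: m => [|m [Cm IHm]].
  by rewrite !big_geq//; split; [exact: C0 | exact: representation0].
rewrite !big_nat_recr//= addrC.
by split; [exact: CZD | rewrite piZD// IHm addrC].
Qed.

(** pi is linear and isometric on C only, hence continuous along sequences in
    C. *)
Lemma representation_cvg (u : nat -> V) (v : V) :
  (forall n, C (u n)) -> u @ \oo --> v -> C v /\ pi \o u @ \oo --> pi v.
Proof.
move=> Cu uv; have Cv : C v.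
  have [Ccl _ _ _] := C_alg.
  by apply: (@closed_cvg _ _ \oo _ u C Ccl _ v uv); exact: nearW.
split=> //; apply/cvgrPdist_le => e e0.
have /cvgrPdist_le/(_ e e0) := uv; apply: filterS => n.
by rewrite /= -representationB// pi_norm//; exact: subalgebraB.
Qed.

(** For s = 1 this says that T acts on C as the Jordan multiplication by d;
    s = -1 gives the inner derivations that commutators of those produce. *)
Definition jordan_mult_intertwine (s : R) (T : bop V) (d : bop H) :=
  forall z, C z -> C (T z) /\ pi (T z) = 2^-1 *: (d * pi z + s *: (pi z * d)).

(** The mixed terms a w d and d w a cancel because left and right
    multiplications commute.  The sign in front of s comes from the right
    multiplications, which compose in the opposite order. *)
Lemma jordan_commutator (s : R) (a d w : bop H) :
  a * (d * w + s *: (w * d)) + (d * w + s *: (w * d)) * a -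
    (d * (a * w + w * a) + s *: ((a * w + w * a) * d)) =
  (a * d - d * a) * w - s *: (w * (a * d - d * a)).
Proof.
have zmod_eq (x y z t u v : bop H) :
    x + y + (z + t) - (v + z + (y + u)) = x - v - (u - t).
  rewrite [x + y]addrC [y + x + _]addrACA [v + z]addrC [z + v + _]addrACA.
  rewrite [z + y]addrC opprD [y + z + (x + t) + _]addrACA subrr add0r.
  by rewrite opprD [x + t + _]addrACA opprB.
rewrite mulrBl mulrBr scalerBr !mulrDl !mulrDr scalerDr.
by rewrite -!bop_scalerAl -!bop_scalerAr !mulrA zmod_eq.
Qed.

Lemma jordan_mult_intertwine_ad x s T d : C x ->
  jordan_mult_intertwine s T d ->
  jordan_mult_intertwine (- s) (ad (Lop x) T) (ad (2^-1 *: pi x) d).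
Proof.
move=> Cx Td z Cz; have [CT piT] := Td _ Cz.
have [CTx piTx] := Td _ (CM Cx Cz).
rewrite -[ad (Lop x) T z]/(jmul x (T z) - T (jmul x z)).
rewrite -[ad _ d]/((2^-1 *: pi x) * d - d * (2^-1 *: pi x)).
split; first by apply: subalgebraB => //; exact: CM.
rewrite representationB//; last exact: CM.
rewrite piTx !piM// piT; move: (pi x) (pi z) => a w.
have scalerC k l (p : bop H) : k *: (l *: p) = l *: (k *: p).
  by rewrite !scalerA mulrC.
rewrite -!bop_scalerAl -!bop_scalerAr -!scalerBr.
rewrite -!bop_scalerAl -!bop_scalerAr [s *: (2^-1 *: _)]scalerC.
rewrite [- s *: (2^-1 *: _)]scalerC.
rewrite -!scalerDr -!scalerBr jordan_commutator.
by rewrite scaleNr.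
Qed.

Lemma jordan_mult_intertwine_iter x y n : C x -> C y ->
  jordan_mult_intertwine ((- 1) ^+ n) ((ad (Lop x) ^+ n) (Lop y))
    ((ad (2^-1 *: pi x) ^+ n) (pi y)).
Proof.
move=> Cx Cy; elim: n => [|n IHn].
  rewrite !expr0 !bop1E => z Cz; rewrite scale1r.
  by split; [exact: CM | exact: piM].
by rewrite !exprS !bopME mulN1r; exact: jordan_mult_intertwine_ad.
Qed.

(** The equation for 1 o a only says that p := pi(a) is (ep + pe) / 2 with
    e = pi(1) idempotent; multiplying by e on either side gives ep = epe = pe,
    hence p = ep = pe. *)
Lemma representation1_unit a : C jone -> C a ->
  pi jone * pi a = pi a /\ pi a * pi jone = pi a.
Proof.
move=> C1 Ca.
have half2 (p : bop H) : 2^-1 *: (p + p) = p.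
  by rewrite -mulr2n -scaler_nat scalerA mulVf ?pnatr_eq0// scale1r.
have : pi jone * pi jone = pi jone.
  by rewrite -[RHS]/(pi jone) -[in RHS](jmul1 jone) piM// half2.
have := piM C1 Ca; rewrite jmul1; move: (pi jone) (pi a) => e p pE ee.
have double : p + p = e * p + p * e.
  by rewrite {1 2}pE -scalerDr half2.
have epe : e * p = e * p * e.
  apply: (addrI (e * p)).
  by rewrite -mulrDr double mulrDr !mulrA ee.
have pee : p * e = e * p * e.
  apply: (addIr (p * e)).
  by rewrite -mulrDl double mulrDl -!mulrA ee.
have ep : p = e * p by rewrite -[LHS]half2 double pee -epe half2.
by split; [rewrite -ep | rewrite pee -epe -ep].
Qed.

Lemma ad_iter_unit (e a d : bop H) n : e * a = a -> a * e = a ->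
  e * d = d -> d * e = d ->
  e * (ad a ^+ n) d = (ad a ^+ n) d /\ (ad a ^+ n) d * e = (ad a ^+ n) d.
Proof.
move=> ea ae ed de; elim: n => [|n [IHl IHr]]; first by rewrite expr0 bop1E.
rewrite exprS bopME; move: ((ad a ^+ n) d) IHl IHr => c ec ce.
rewrite -[ad a c]/(a * c - c * a) mulrBr mulrBl.
by split; [rewrite !mulrA ea ec | rewrite -!mulrA ae ce].
Qed.

Lemma pi_ad_iter x y n : C jone -> C x -> C y ->
  C ((ad (Lop x) ^+ n.*2) (Lop y) jone) /\
  pi ((ad (Lop x) ^+ n.*2) (Lop y) jone) =
    (ad (2^-1 *: pi x) ^+ n.*2) (pi y).
Proof.
move=> C1 Cx Cy; have [CT ->] := jordan_mult_intertwine_iter n.*2 Cx Cy C1.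
split=> //; have [ex xe] := representation1_unit C1 Cx.
have [ey ye] := representation1_unit C1 Cy.
have [| |-> ->] := @ad_iter_unit (pi jone) (2^-1 *: pi x) (pi y) n.*2 _ _ ey ye.
- by rewrite -bop_scalerAr ex.
- by rewrite -bop_scalerAl xe.
rewrite -signr_odd odd_double expr0 scale1r -mulr2n -scaler_nat scalerA.
by rewrite mulVf ?pnatr_eq0// scale1r.
Qed.

Lemma representation_sinhc x y : C jone -> C x -> C y ->
  C (sinhc (ad (Lop x)) (Lop y) jone) /\
  pi (sinhc (ad (Lop x)) (Lop y) jone) = sinhc (ad (2^-1 *: pi x)) (pi y).
Proof.
move=> C1 Cx Cy.
pose c n : R := (n.*2.+1)`!%:R^-1.
pose v n : V := (ad (Lop x) ^+ n.*2) (Lop y) jone.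
have Cv n : C (v n) by have [] := pi_ad_iter n C1 Cx Cy.
pose u m : V := \sum_(0 <= n < m) c n *: v n.
have uE : u = fun m =>
    (\sum_(0 <= n < m) c n *: (ad (Lop x) ^+ n.*2) (Lop y)) jone.
  by apply/funext => m; rewrite bop_sumE.
have u_cvg : u @ \oo --> sinhc (ad (Lop x)) (Lop y) jone.
  by rewrite uE; apply: cvg_bop_apply; exact: sinhc_apply_cvg.
have Cu m : C (u m) by have [] := representation_sum c m Cv.
have [Csum pi_cvg] := representation_cvg Cu u_cvg; split=> //.
apply: (cvg_unique _ pi_cvg); first exact: norm_hausdorff.
have -> : pi \o u =
    fun m => \sum_(0 <= n < m) c n *: (ad (2^-1 *: pi x) ^+ n.*2) (pi y).
  apply/funext => m; rewrite /= (representation_sum c m Cv).2.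
  by apply: eq_bigr => n _; rewrite (pi_ad_iter n C1 Cx Cy).2.
exact: sinhc_apply_cvg.
Qed.

End Intertwining.

Theorem lemma4p5 (R : realType) (V : jbAlgType R) (x y : V)
    (H : hilbertType R) (pi : V -> bop H)
    (hpi : isometric_representation (JBgen x y) pi) :
  JBgen x y (sinhc (ad (Lop x)) (Lop y) jone) /\
  pi (sinhc (ad (Lop x)) (Lop y) jone) = sinhc (ad (2^-1 *: pi x)) (pi y).
Proof.
apply: representation_sinhc => //; first exact: JBgen_closed_JB_subalgebra.
- by apply: JBgen_gen; left; left.
- by apply: JBgen_gen; left; right.
- by apply: JBgen_gen; right.
Qed.
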